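(* For all integers $n\ge 0$ and $k\ge 0$, let $P_{n,k}$ be the set of triples of partitions defined in the context, and let $$H_{n,k}=\{(\tau,\lambda,\mu)\in P_{n,k} : m_k(\lambda)+2>m_k(\mu)\}.$$ Then, for any positive integer $n$ and any nonnegative integer $k$, there is a weight-preserving bijection $$\phi_{n,k}\colon P_{n,k}\longrightarrow \big(\{n\}\times P_{n,k}\big)\ \cup\ \big(\{2n-1\}\times P_{n-1,k}\big)\ \cup\ H_{n,k}\ \cup\ H_{n,k+1},$$ where $\cup$ denotes disjoint union, and the weights $w$ (monomials in the indeterminates $a,q$) are given by $$w(\tau,\lambda,\mu)=a^n q^{|\tau|+|\lambda|+|\mu|}\quad\text{for }(\tau,\lambda,\mu)\in P_{n,k},$$ and by the same formula on $H_{n,k}\subseteq P_{n,k}$ and on $H_{n,k+1}\subseteq P_{n,k+1}$, together with $$w\big(n,(\tau,\lambda,\mu)\big)=q^n\cdot a^n q^{|\tau|+|\lambda|+|\mu|}\quad\text{for }(n,(\tau,\lambda,\mu))\in\{n\}\times P_{n,k},$$ $$w\big(2n-1,(\tau,\lambda,\mu)\big)=a q^{2n-1}\cdot a^{n-1}q^{|\tau|+|\lambda|+|\mu|}\quad\text{for }(2n-1,(\tau,\lambda,\mu))\in\{2n-1\}\times P_{n-1,k}.$$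
   Context: A partition is a non-increasing finite (possibly empty) sequence of positive integers $\lambda=(\lambda_1,\dots,\lambda_\ell)$; the $\lambda_i$ are its parts, $|\lambda|=\lambda_1+\cdots+\lambda_\ell$ is the sum of the parts, $\ell(\lambda)=\ell$ is the number of parts, and $\varnothing$ is the partition with no parts. For $k\ge 1$, $m_k(\lambda)$ denotes the number of parts of $\lambda$ equal to $k$; by convention $m_0(\lambda)=+\infty$ for every partition $\lambda$. In particular the condition $m_0(\lambda)+2>m_0(\mu)$ is false, so $H_{n,0}=\emptyset$. For an integer $k\ge 0$, $P_k$ is the set of triples $(\tau,\lambda,\mu)$ of partitions such that: $\tau=(k^{2k},k-1,\dots,2,1)$, i.e. the part $k$ repeated $2k$ times followed by $k-1,k-2,\dots,2,1$ (so $|\tau|=k(5k-1)/2$); every part of $\lambda$ is at least $k$ and no part of $\lambda$ equals $2k$; and every part of $\mu$ is at most $k$. The conditions on parts are vacuous for the empty partition. In particular $P_0=\{(\varnothing,\lambda,\varnothing):\lambda\text{ a partition}\}$. For integers $n,k\ge 0$, $P_{n,k}=\{(\tau,\lambda,\mu)\in P_k:\ell(\lambda)=n-2k\}$; thus $P_{n,0}=\{(\varnothing,\lambda,\varnothing):\ell(\lambda)=n\}$ and $P_{n,k}=\emptyset$ for $n<2k$. A bijection $\phi$ is weight-preserving if $w(\phi(\alpha))=w(\alpha)$ for every $\alpha$ in its domain. *)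

(* Defs.v *)
From HB Require Import structures.
From mathcomp Require Import all_boot all_order all_algebra.
From mathcomp Require Import mpoly.

Set Implicit Arguments.
Unset Strict Implicit.
Unset Printing Implicit Defensive.

Import GRing.Theory.

Local Open Scope nat_scope.

Definition is_intpart (s : seq nat) : bool := sorted geq s && (0 \notin s).

Record intpart := IntPart { parts :> seq nat; _ : is_intpart parts }.

HB.instance Definition _ := [isSub for parts].
HB.instance Definition _ := [Choice of intpart by <:].

(* Extended natural numbers: [None] stands for +oo. *)
Definition enat := option nat.

Definition enat_add (x : enat) (m : nat) : enat :=
  if x is Some n then Some (n + m) else None.

Definition enat_lt (x y : enat) : bool :=
  match x, y with
  | Some m, Some n => m < n
  | Some _, None => true
  | None, _ => false
  end.

(* By convention every partition has infinitely many parts equal to 0. *)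
Definition mult (k : nat) (s : intpart) : enat :=
  if k == 0 then None else Some (count_mem k s).

Definition triple : Type := (intpart * intpart * intpart)%type.

Definition inPk (k : nat) (x : triple) : bool :=
  let: (tau, lam, mu) := x in
  [&& parts tau == nseq (2 * k) k ++ rev (iota 1 k.-1),
      all (fun i => k <= i) lam,
      2 * k \notin parts lam
    & all (fun i => i <= k) mu].

(* [size lam + 2 * k == n] is the untruncated [size lam = n - 2k]; no triple
   qualifies when [n < 2 * k]. *)
Definition inP (n k : nat) (x : triple) : bool :=
  let: (tau, lam, mu) := x in inPk k x && (size lam + 2 * k == n).

Definition inH (n k : nat) (x : triple) : bool :=
  let: (tau, lam, mu) := x in
  inP n k x && enat_lt (mult k mu) (enat_add (mult k lam) 2).

Definition Pnk (n k : nat) : Type := {x : triple | inP n k x}.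

Definition Hnk (n k : nat) : Type := {x : triple | inH n k x}.

Definition single (m : nat) : Type := {i : nat | i == m}.

(* [2 * n - 1] and [n.-1] are truncated, so this is only meaningful for
   [0 < n]. *)
Definition target (n k : nat) : Type :=
  (single n * Pnk n k + single (2 * n - 1) * Pnk n.-1 k + Hnk n k + Hnk n k.+1)%type.

Local Open Scope ring_scope.

Definition indet_a : {mpoly int[2]} := 'X_0.
Definition indet_q : {mpoly int[2]} := 'X_1.

Definition weight (n : nat) (x : triple) : {mpoly int[2]} :=
  let: (tau, lam, mu) := x in
  indet_a ^+ n * indet_q ^+ (sumn tau + sumn lam + sumn mu).

Definition weightP (n k : nat) (x : Pnk n k) : {mpoly int[2]} :=
  weight n (val x).

Definition weightT (n k : nat) (y : target n k) : {mpoly int[2]} :=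
  match y with
  | inl (inl (inl (m, x))) => indet_q ^+ val m * weight n (val x)
  | inl (inl (inr (m, x))) =>
      indet_a * indet_q ^+ val m * weight n.-1 (val x)
  | inl (inr x) => weight n (val x)
  | inr x => weight n (val x)
  end.

(* Main.v *)
(** Fix [k] and drop [tau] from the triples; only [q]-weights matter, [n] being
    kept track of through the number of parts of [lambda].
    - If [m_k(mu) >= m_k(lambda) + 2] (the complement of [H_{n,k}]), join each
      part [k] of [lambda] with a part [k] of [mu] into a part [2k] of [lambda],
      and discard two further parts [k] of [mu].  What is left is an arbitrary
      pair with all parts of [lambda] above [k] and all parts of [mu] at most
      [k]; for [k = 0] nothing is moved.
    - If [2k+1] is not a part of [lambda], subtracting 1 from every part of
      [lambda] gives [{n} x P_{n,k}].  Otherwise delete one part [2k+1].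
    - After the deletion, if neither [k+1] nor [2k+2] is a part of [lambda],
      subtracting 2 from every part gives [{2n-1} x P_{n-1,k}].
    - Otherwise [lambda] has [a] parts [k+1] and [b] parts [2k+2], with
      [a + b > 0].  Delete one part [k+1] if [a > 0], then break each [2k+2]
      into a [k+1] in [lambda] and a [k+1] in [mu]; if [a = 0], delete one of
      the resulting [k+1] of [lambda].  This leaves [a + b - 1] parts [k+1] in
      [lambda] and [b] in [mu], which is the condition defining [H_{n,k+1}]. *)

Require Import Defs.
From mathcomp Require Import all_boot.
From mathcomp Require Import all_algebra mpoly zify.

Set Implicit Arguments.
Unset Strict Implicit.
Unset Printing Implicit Defensive.

(** * Weight-preserving bijections *)

Definition wequiv (W A B : Type) (wA : A -> W) (wB : B -> W) : Prop :=
  exists f : A -> B, bijective f /\ forall x, wB (f x) = wA x.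

Definition wsum (W A B : Type) (wA : A -> W) (wB : B -> W) (x : A + B) : W :=
  match x with inl a => wA a | inr b => wB b end.

Lemma wequiv_trans (W A B C : Type) (wA : A -> W) (wB : B -> W) (wC : C -> W) :
  wequiv wA wB -> wequiv wB wC -> wequiv wA wC.
Proof.
move=> [f [bf wf]] [g [bg wg]]; exists (g \o f); split; first exact: bij_comp.
by move=> x /=; rewrite wg wf.
Qed.

Lemma wequiv_sum (W A B A' B' : Type) (wA : A -> W) (wB : B -> W)
    (wA' : A' -> W) (wB' : B' -> W) :
  wequiv wA wA' -> wequiv wB wB' -> wequiv (wsum wA wB) (wsum wA' wB').
Proof.
move=> [f [[f' fK f'K] wf]] [g [[g' gK g'K] wg]].
exists (fun x => match x with inl a => inl (f a) | inr b => inr (g b) end).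
split; last by case.
exists (fun x => match x with inl a => inl (f' a) | inr b => inr (g' b) end).
- by case=> x; rewrite ?fK ?gK.
- by case=> x; rewrite ?f'K ?g'K.
Qed.

(** Lets each bijection be given by total maps on the ambient types, mutually inverse only on [P]
    and [Q]. *)
Lemma wequiv_sub (W T U : Type) (P : pred T) (Q : pred U) (wT : T -> W)
    (wU : U -> W) (f : T -> U) (g : U -> T) :
  (forall x, P x -> [/\ Q (f x), g (f x) = x & wU (f x) = wT x]) ->
  (forall y, Q y -> P (g y) /\ f (g y) = y) ->
  wequiv (fun x : {x | P x} => wT (val x)) (fun y : {y | Q y} => wU (val y)).
Proof.
move=> fP gP.
have Qf x : P x -> Q (f x) by move=> /fP[].
have Pg y : Q y -> P (g y) by move=> /gP[].
exists (fun x => exist _ (f (val x)) (Qf _ (valP x))).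
split=> [|x]; last by have [] := fP _ (valP x).
exists (fun y => exist _ (g (val y)) (Pg _ (valP y))) => [x|y]; apply: val_inj => /=.
- by have [] := fP _ (valP x).
- by have [] := gP _ (valP y).
Qed.

(** Turns each case distinction of the construction into a disjoint union. *)
Lemma wequiv_split (W T : Type) (P Q : pred T) (w : T -> W) :
  wequiv (fun x : {x | P x} => w (val x))
    (wsum (fun x : {x | P x && Q x} => w (val x))
          (fun x : {x | P x && ~~ Q x} => w (val x))).
Proof.
have PQ (x : {x | P x}) : Q (val x) -> P (val x) && Q (val x).
  by rewrite (valP x).
have PnQ (x : {x | P x}) : ~ Q (val x) -> P (val x) && ~~ Q (val x).
  by move=> /negP ->; rewrite (valP x).
pose f (x : {x | P x}) : {x | P x && Q x} + {x | P x && ~~ Q x} :=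
  match decP (@idP (Q (val x))) with
  | left q => inl (exist _ (val x) (PQ x q))
  | right nq => inr (exist _ (val x) (PnQ x nq))
  end.
have P1 (x : {x | P x && Q x}) : P (val x) by case/andP: (valP x).
have P2 (x : {x | P x && ~~ Q x}) : P (val x) by case/andP: (valP x).
exists f; split; last by move=> x; rewrite /f; case: decP.
exists (fun y => match y with
  | inl x => exist _ (val x) (P1 x) | inr x => exist _ (val x) (P2 x) end).
- by move=> x; apply: val_inj; rewrite /f; case: decP.
- case=> x; case/andP: (valP x) => _ /= Qx; rewrite /f /=; case: decP => //= q.
  + by congr inl; apply: val_inj.
  + by rewrite q in Qx.
  + by congr inr; apply: val_inj.
Qed.

Lemma wequiv_single (W A : Type) (m : nat) (w : A -> W) (w' : single m * A -> W) :
  (forall x : single m * A, w' x = w x.2) -> wequiv w w'.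
Proof.
move=> ww'; exists (fun a => (exist _ m (eqxx m), a)); split=> [|a]; last by rewrite ww'.
exists (fun x => x.2) => // -[[i /= im] a] /=.
by congr pair; apply: val_inj; rewrite /= (eqP im).
Qed.

(** * Partitions as finite multisets of positive integers *)

Lemma mkpart_subproof (s : seq nat) : is_intpart (sort geq (filter (predC1 0) s)).
Proof.
rewrite /is_intpart sort_sorted; last by move=> x y; apply: leq_total.
by rewrite mem_sort mem_filter.
Qed.

Definition mkpart (s : seq nat) : intpart := IntPart (mkpart_subproof s).

Lemma intpart0 (s : intpart) : 0 \notin parts s.
Proof. by case: s => s /= /andP[]. Qed.

(* [nb] fixes the carrier of [count_mem] to [nat], so that [lia] sees one atom. *)
Definition nb (i : nat) (s : intpart) : nat := count_mem i s.

Lemma nb_eq0 (i : nat) (s : intpart) : i \notin parts s -> nb i s = 0.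
Proof. by move/count_memPn. Qed.

Lemma nb_gt0 (i : nat) (s : intpart) : (i \in parts s) = (0 < nb i s).
Proof. by rewrite -has_pred1 has_count. Qed.

Lemma perm_mkpart (s : seq nat) : perm_eq (mkpart s) (filter (predC1 0) s).
Proof. by rewrite /= perm_sort. Qed.

Lemma perm_mkpart_pos (s : seq nat) : 0 \notin s -> perm_eq (mkpart s) s.
Proof.
move=> s0; rewrite (perm_trans (perm_mkpart s)) //.
by rewrite (all_filterP _) //; apply/allP=> x xs /=; apply: contraNneq s0 => <-.
Qed.

Lemma perm_intpart (s t : intpart) : perm_eq s t -> s = t.
Proof.
move=> st; apply: val_inj => /=.
have srt (u : intpart) : sorted geq u by case: u => u /= /andP[].
apply: (sorted_eq _ _ (srt s) (srt t) st).
- by move=> x y z xy yz; apply: leq_trans xy.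
- by move=> x y /= H; apply/eqP; rewrite eqn_leq andbC.
Qed.

(** Sorted sequences with equal multiplicities coincide; the inverse laws for [set_mult] thus reduce
    to counting. *)
Lemma intpart_ext (s t : intpart) :
  (forall i, nb i s = nb i t) -> s = t.
Proof.
move=> st; apply/perm_intpart/allP=> i _ /=; apply/eqP; exact: st.
Qed.

(** * Prescribing the multiplicity of one part *)

Definition set_mult (c i : nat) (s : intpart) : intpart :=
  mkpart (nseq c i ++ filter (predC1 i) s).

Lemma perm_set_mult (c i : nat) (s : intpart) : 0 < i ->
  perm_eq (set_mult c i s) (nseq c i ++ filter (predC1 i) s).
Proof.
move=> i0; apply: perm_mkpart_pos.
by rewrite mem_cat mem_nseq mem_filter negb_or (negbTE (intpart0 s)) andbF; case: c i i0 => [|c] [].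
Qed.

(** [mkpart] discards the added zeros. Hence [pair_off] moves nothing when [k = 0]. *)
Lemma set_mult0 (c : nat) (s : intpart) : set_mult c 0 s = s.
Proof.
apply/perm_intpart; rewrite (perm_trans (perm_mkpart _)) // filter_cat filter_nseq /= filter_id.
rewrite (all_filterP _) //; apply/allP=> x xs /=.
by apply: contraNneq (intpart0 s) => <-.
Qed.

Lemma nb_set_mult (c i j : nat) (s : intpart) : 0 < i ->
  nb j (set_mult c i s) = if j == i then c else nb j s.
Proof.
move=> i0; rewrite /nb (seq.permP (perm_set_mult c s i0)) count_cat count_nseq count_filter /=.
rewrite [i == j]eq_sym; case: eqP => [->|ji].
  rewrite mul1n (eq_count (a2 := pred0)) ?count_pred0 ?addn0 // => x /=.
  by case: eqP.
rewrite add0n; apply: eq_count => x /=; case: eqP => // ->.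
by case: eqP ji.
Qed.

Lemma mem_set_mult (c i j : nat) (s : intpart) : 0 < i ->
  (j \in parts (set_mult c i s)) = if j == i then 0 < c else j \in parts s.
Proof. by move=> i0; rewrite !nb_gt0 nb_set_mult //; case: eqP. Qed.

Lemma size_set_mult (c i : nat) (s : intpart) : 0 < i ->
  size (set_mult c i s) + nb i s = size s + c.
Proof.
move=> i0; rewrite (perm_size (perm_set_mult c s i0)) size_cat size_nseq size_filter.
by rewrite -(count_predC (pred1 i) s) addnAC -addnA addnC.
Qed.

Lemma sumn_filter_predC1 (i : nat) (s : seq nat) :
  sumn (filter (predC1 i) s) + i * count_mem i s = sumn s.
Proof.
elim: s => [|x s IH] /=; first by rewrite muln0.
by rewrite -IH; case: (eqVneq x i) => [->|_] /=; rewrite ?mulnDr ?muln0 ?muln1; lia.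
Qed.

Lemma sumn_set_mult (c i : nat) (s : intpart) :
  sumn (set_mult c i s) + i * nb i s = sumn s + i * c.
Proof.
have [->|i0] := posnP i; first by rewrite set_mult0.
rewrite (perm_sumn (perm_set_mult c s i0)) sumn_cat sumn_nseq.
by rewrite -(sumn_filter_predC1 i s) -/(nb i s); lia.
Qed.

(** * Shifting all parts by a constant *)

Definition shift_up (d : nat) (s : intpart) : intpart := mkpart (map (addn d) s).

Definition shift_down (d : nat) (s : intpart) : intpart := mkpart (map (subn^~ d) s).

Lemma perm_shift_up (d : nat) (s : intpart) :
  perm_eq (shift_up d s) (map (addn d) s).
Proof.
apply: perm_mkpart_pos; apply/mapP=> -[x xs]; have := intpart0 s.
by case: x xs => [-> //|x _ _]; lia.
Qed.

Lemma perm_shift_down (d : nat) (s : intpart) : all (ltn d) s ->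
  perm_eq (shift_down d s) (map (subn^~ d) s).
Proof.
by move=> /allP ds; apply: perm_mkpart_pos; apply/mapP=> -[x /ds /=]; lia.
Qed.

(** Parts are positive, so shifted parts exceed [d]: the subtraction is exact and no part is lost as
    a zero. *)
Lemma shift_upK (d : nat) : cancel (shift_up d) (shift_down d).
Proof.
move=> s; have us := perm_shift_up d s.
have ds : all (ltn d) (shift_up d s).
  rewrite (perm_all _ us) all_map; apply/allP => x xs /=.
  by rewrite -addn1 leq_add2l lt0n; apply: contraNneq (intpart0 s) => <-.
apply: perm_intpart; rewrite (perm_trans (perm_shift_down ds)) //.
rewrite (perm_trans (perm_map _ us)) // -map_comp map_id_in // => x _ /=.
by rewrite addKn.
Qed.

Lemma shift_downK (d : nat) (s : intpart) : all (ltn d) s ->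
  shift_up d (shift_down d s) = s.
Proof.
move=> ds; apply: perm_intpart; rewrite (perm_trans (perm_shift_up _ _)) //.
rewrite (perm_trans (perm_map _ (perm_shift_down ds))) // -map_comp map_id_in //.
by move=> x /(allP ds) /= dx; lia.
Qed.

Lemma mem_shift_up (d i : nat) (s : intpart) :
  (i \in parts (shift_up d s)) = (d <= i) && (i - d \in parts s).
Proof.
rewrite (perm_mem (perm_shift_up d s)); apply/mapP/andP => [[x xs ->]|[di ids]].
  by rewrite leq_addr addKn.
by exists (i - d) => //; lia.
Qed.

Lemma mem_shift_down (d i : nat) (s : intpart) : all (ltn d) s ->
  (i \in parts (shift_down d s)) = (i + d \in parts s).
Proof.
by move=> ds; rewrite -{2}(shift_downK ds) mem_shift_up leq_addl addnK.
Qed.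

Lemma size_shift_up (d : nat) (s : intpart) : size (shift_up d s) = size s.
Proof. by rewrite (perm_size (perm_shift_up d s)) size_map. Qed.

Lemma size_shift_down (d : nat) (s : intpart) : all (ltn d) s ->
  size (shift_down d s) = size s.
Proof. by move=> /shift_downK{2}<-; rewrite size_shift_up. Qed.

Lemma sumn_shift_up (d : nat) (s : intpart) :
  sumn (shift_up d s) = sumn s + d * size s.
Proof.
rewrite (perm_sumn (perm_shift_up d s)).
by elim: (parts s) => [|x t IH] /=; rewrite ?IH ?mulnS; lia.
Qed.

Lemma sumn_shift_down (d : nat) (s : intpart) : all (ltn d) s ->
  sumn s = sumn (shift_down d s) + d * size s.
Proof.
by move=> ds; rewrite -{1}(shift_downK ds) sumn_shift_up size_shift_down.
Qed.

(** * The fixed component [tau] *)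

Lemma tau_subproof (k : nat) : is_intpart (nseq (2 * k) k ++ rev (iota 1 k.-1)).
Proof.
rewrite /is_intpart mem_cat mem_nseq mem_rev mem_iota /= orbF; apply/andP; split; last by case: k.
rewrite sorted_pairwise; last by move=> x y z xy yz; apply: leq_trans xy.
rewrite pairwise_cat -!sorted_pairwise; try by move=> x y z xy yz; apply: leq_trans xy.
apply/and3P; split.
- by apply/allrelP => x y /nseqP[-> _]; rewrite mem_rev mem_iota /=; lia.
- by elim: (2 * k) => //= -[|m] //= ->; rewrite leqnn.
- by rewrite rev_sorted; exact: iota_sorted.
Qed.

Definition tau (k : nat) : intpart := IntPart (tau_subproof k).

(** The repeated part contributes [2(k+1)^2 - 2k^2 = 4k+2] more, and the sum of the tail grows by
    [k]. *)
Lemma sumn_tauS (k : nat) : sumn (tau k.+1) = sumn (tau k) + 5 * k + 2.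
Proof.
have tauE j : sumn (tau j) = j * (2 * j) + sumn (iota 1 j.-1).
  by rewrite [LHS]sumn_cat sumn_nseq sumn_rev.
rewrite !tauE; case: k => [|k] //.
have -> : iota 1 k.+2.-1 = iota 1 k ++ [:: k.+1] by rewrite -[k.+2.-1]addn1 iotaD.
by rewrite sumn_cat /=; lia.
Qed.

(** * Exponents of [q] and reduction to pairs *)

Definition wt (x : triple) : nat :=
  let: (tau, lam, mu) := x in sumn tau + sumn lam + sumn mu.

Definition lam_mu : Type := (intpart * intpart)%type.

(* [l] counts the parts already deleted from [lambda] (at most one, [2k+1]), and
   [c] below is the weight discarded so far. *)
Definition inD (n k l : nat) (x : lam_mu) : bool :=
  [&& all (ltn k) x.1, all (geq k) x.2 & size x.1 + 2 * k + l == n].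

Definition wtD (k c : nat) (x : lam_mu) : nat := sumn (tau k) + c + sumn x.1 + sumn x.2.

Lemma inPkE (n k : nat) (x : triple) : inP n k x =
  [&& x.1.1 == tau k, all (leq k) x.1.2, 2 * k \notin parts x.1.2,
      all (geq k) x.2 & size x.1.2 + 2 * k == n].
Proof. by case: x => -[t lam] mu /=; rewrite -!andbA; congr andb. Qed.

Opaque set_mult shift_up shift_down tau.

(** At [k = 0] the infinite multiplicity makes the comparison false; otherwise both counts are
    finite. *)
Lemma enat_lt_mult (k : nat) (lam mu : intpart) :
  enat_lt (mult k mu) (enat_add (mult k lam) 2) =
  (0 < k) && (nb k mu < nb k lam + 2).
Proof. by rewrite /mult; case: k. Qed.

Lemma inHE (n k : nat) (x : triple) : inH n k x =
  [&& inP n k x, 0 < k & nb k x.2 < nb k x.1.2 + 2].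
Proof. by case: x => -[t lam] mu; rewrite /inH enat_lt_mult. Qed.

Lemma all_set_mult (p : pred nat) (c i : nat) (s : intpart) : 0 < i ->
  (forall j, j \in parts s -> j != i -> p j) -> (0 < c -> p i) ->
  all p (set_mult c i s).
Proof.
move=> i0 ps pi; apply/allP => j; rewrite mem_set_mult //.
by case: eqP => [-> //|/eqP ji js]; apply: ps.
Qed.

(** * Pairing off the parts [k] *)

Definition pair_off (k : nat) (x : triple) : lam_mu :=
  let m := nb k x.1.2 in
  (set_mult m (2 * k) (set_mult 0 k x.1.2),
   set_mult (nb k x.2 - (m + 2)) k x.2).

Definition unpair_off (k : nat) (y : lam_mu) : triple :=
  let m := nb (2 * k) y.1 in
  (tau k, set_mult m k (set_mult 0 (2 * k) y.1),
   set_mult (nb k y.2 + (m + 2)) k y.2).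

(** Merging keeps the total weight and the length of [lam]; the two parts [k] discarded from [mu]
    account for [2 * k]. As [lam] had no part [2k], the multiplicity of [2k] afterwards recovers
    [m]. *)
Lemma wequiv_notH (n k : nat) :
  wequiv (fun x : {x | inP n k x && ~~ inH n k x} => wt (val x))
         (fun y : {y | inD n k 0 y} => wtD k (2 * k) (val y)).
Proof.
apply: (wequiv_sub (f := pair_off k) (g := unpair_off k)).
- move=> [[t lam] mu]; rewrite inHE inPkE /=.
  case/andP=> /and5P[/eqP -> lamk lam2k muk /eqP sz].
  rewrite eqxx lamk lam2k muk sz eqxx /= /pair_off /unpair_off /wtD /inD /=.
  have [k_0|k0] := posnP k.
    (* Here [H] is empty and the required bound [0 < i] is the positivity of parts. *)
    rewrite k_0 /= !set_mult0 => _; split=> //.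
    apply/and3P; split; [|by rewrite -k_0|by apply/eqP; lia].
    by apply/allP => i; rewrite /= lt0n; apply: contraTneq => ->; exact: intpart0.
  (* Outside [H] the subtraction in [pair_off] is exact. *)
  rewrite -leqNgt => /subnK; set c := (_ - _) => cE.
  have c2 : nb (2 * k) lam = 0 by apply: nb_eq0.
  have k2 : (2 * k == k) = false by lia.
  have k02 : 0 < 2 * k by lia.
  have := size_set_mult (nb k lam) (set_mult 0 k lam) k02.
  have := size_set_mult 0 lam k0.
  have := sumn_set_mult (nb k lam) (2 * k) (set_mult 0 k lam).
  have := sumn_set_mult 0 k lam.
  have := sumn_set_mult c k mu; rewrite -[in k * _]cE.
  rewrite !nb_set_mult // eqxx k2 c2 => e1 e2 e3 e4 e5.
  split.
  + apply/and3P; split; last by apply/eqP; lia.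
    * apply: all_set_mult => //= [j|]; last by lia.
      rewrite mem_set_mult //; case: eqP => // jk /(allP lamk) kj _.
      by rewrite ltn_neqAle; apply/andP; split=> //; apply/eqP; lia.
    * by apply: all_set_mult => //= j /(allP muk).
  + congr (_, _, _); apply: intpart_ext => j; rewrite !nb_set_mult //.
      by case: (eqVneq j k) => [->//|jk]; case: eqP => [->|].
    by case: (eqVneq j k) => [->|//]; rewrite eqxx; lia.
  + lia.
- move=> [lam mu]; rewrite inHE inPkE => /and3P[/= lamk muk /eqP sz].
  rewrite /pair_off /unpair_off /= eqxx /=.
  have [k_0|k0] := posnP k.
    rewrite k_0 /= !set_mult0 andbF andbT; split=> //.
    apply/and4P; split=> //; [exact/allP|exact: intpart0|by rewrite -k_0|].
    by apply/eqP; lia.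
  have c1 : nb k lam = 0 by apply: nb_eq0; apply/negP => /(allP lamk) /=; lia.
  have k2 : (2 * k == k) = false by lia.
  have k2' : (k == 2 * k) = false by lia.
  have k02 : 0 < 2 * k by lia.
  have := size_set_mult (nb (2 * k) lam) (set_mult 0 (2 * k) lam) k0.
  have := size_set_mult 0 lam k02.
  rewrite !nb_set_mult // !eqxx k2' c1 => e1 e2.
  split.
  + have -> /= : (nb k mu + (nb (2 * k) lam + 2) < nb (2 * k) lam + 2) = false by lia.
    rewrite !andbF andbT; apply/and4P; split; last by apply/eqP; lia.
    * apply: all_set_mult => //= j.
      rewrite mem_set_mult //; case: eqP => // _ /(allP lamk) /= kj _.
      exact: ltnW.
    * by rewrite mem_set_mult // k2 mem_set_mult // eqxx.
    * by apply: all_set_mult => //= j /(allP muk).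
  + congr (_, _); apply: intpart_ext => j; rewrite !nb_set_mult //.
      case: (eqVneq j (2 * k)) => [->//|jk].
      by case: (eqVneq j k) => [->|].
    by case: (eqVneq j k) => [->|//]; lia.
Qed.

(** * Shifts by 1 and 2, and deletion of a part [2k+1] *)

Lemma wequiv_shift1 (n k : nat) :
  wequiv (fun y : {y | inD n k 0 y && (2 * k + 1 \notin parts y.1)} =>
            wtD k (2 * k) (val y))
         (fun x : {x | inP n k x} => n + wt (val x)).
Proof.
apply: (wequiv_sub (wU := fun x => n + wt x)
                   (f := fun y : lam_mu => (tau k, shift_down 1 y.1, y.2) : triple)
                   (g := fun x : triple => (shift_up 1 x.1.2, x.2) : lam_mu)).
- move=> [lam mu]; rewrite inPkE => /andP[/and3P[/= lamk muk /eqP sz] lam2k].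
  (* For [k > 0] this follows from [lamk]; for [k = 0] it is the absence of [2k+1 = 1] that keeps
     every part above 1. *)
  have lam1 : all (ltn 1) (parts lam).
    apply/allP => j jl; have /= := allP lamk _ jl.
    by have : j != 2 * k + 1 by [apply: contraNneq lam2k => <-]; lia.
  (* The shift removes [n - 2k], one per part; with the [2k] discarded before, this makes [n]. *)
  have e := sumn_shift_down lam1.
  split; [|by rewrite shift_downK|by rewrite /wtD /=; lia].
  apply/and5P; split=> //; last by rewrite size_shift_down // -sz addn0.
    by apply/allP => j; rewrite mem_shift_down // => /(allP lamk) /=; lia.
  by rewrite mem_shift_down.
- move=> [[t lam] mu]; rewrite inPkE /= => /and5P[/eqP-> lamk lam2k muk /eqP sz].
  rewrite shift_upK; split=> //; apply/andP; split.
    apply/and3P; split=> //=; last by rewrite size_shift_up sz addn0.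
    by apply/allP => j; rewrite mem_shift_up => /andP[j0 /(allP lamk)] /=; lia.
  by rewrite mem_shift_up addnK leq_addl.
Qed.

(** The deleted part raises the discarded weight from [2k] to [2k + (2k+1)]; its multiplicity,
    formerly positive, becomes arbitrary. *)
Lemma wequiv_drop (n k : nat) :
  wequiv (fun y : {y | inD n k 0 y && ~~ (2 * k + 1 \notin parts y.1)} =>
            wtD k (2 * k) (val y))
         (fun y : {y | inD n k 1 y} => wtD k (4 * k + 1) (val y)).
Proof.
apply: (wequiv_sub
  (f := fun y : lam_mu => (set_mult (nb (2 * k + 1) y.1).-1 (2 * k + 1) y.1, y.2) : lam_mu)
  (g := fun y : lam_mu => (set_mult (nb (2 * k + 1) y.1).+1 (2 * k + 1) y.1, y.2) : lam_mu)).
- move=> [lam mu] /andP[/and3P[/= lamk muk /eqP sz]].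
  have k0 : 0 < 2 * k + 1 by lia.
  rewrite negbK nb_gt0; case e: (nb _ lam) => [//|c] _ /=.
  have := size_set_mult c lam k0; have := sumn_set_mult c (2 * k + 1) lam.
  rewrite e => e1 e2.
  split; last by rewrite /wtD /=; lia.
    apply/and3P; split=> //=; last by apply/eqP; lia.
    by apply: all_set_mult => // [j /(allP lamk)|_] //=; lia.
  congr (_, _); apply: intpart_ext => j; rewrite !nb_set_mult // eqxx -e.
  by case: (eqVneq j (2 * k + 1)) => [->|].
- move=> [lam mu] /and3P[/= lamk muk /eqP sz].
  have k0 : 0 < 2 * k + 1 by lia.
  have e := size_set_mult (nb (2 * k + 1) lam).+1 lam k0.
  split.
    rewrite negbK mem_set_mult // eqxx andbT; apply/and3P; split=> //=; last by apply/eqP; lia.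
    by apply: all_set_mult => // [j /(allP lamk)|_] //=; lia.
  congr (_, _); apply: intpart_ext => j; rewrite !nb_set_mult // eqxx.
  by case: (eqVneq j (2 * k + 1)) => [->|].
Qed.

Definition no_low_part (k : nat) (y : lam_mu) : bool :=
  (k.+1 \notin parts y.1) && (2 * k.+1 \notin parts y.1).

(** [lam] now has [n-1-2k] parts, so the shift removes [2(n-1-2k)], which with the discarded [4k+1]
    makes [2n-1]. The absence of [k+1] and [2k+2] becomes the lower bound [k] and the absence of
    [2k]. *)
Lemma wequiv_shift2 (n k : nat) : 0 < n ->
  wequiv (fun y : {y | inD n k 1 y && no_low_part k y} => wtD k (4 * k + 1) (val y))
         (fun x : {x | inP n.-1 k x} => 2 * n - 1 + wt (val x)).
Proof.
move=> n0.
apply: (wequiv_sub (wU := fun x => 2 * n - 1 + wt x)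
                   (f := fun y : lam_mu => (tau k, shift_down 2 y.1, y.2) : triple)
                   (g := fun x : triple => (shift_up 2 x.1.2, x.2) : lam_mu)).
- move=> [lam mu]; rewrite inPkE => /andP[/and3P[/= lamk muk /eqP sz] /andP[/= lamk1 lam2k]].
  have lam1 : all (ltn 2) (parts lam).
    apply/allP => j jl; have /= := allP lamk _ jl.
    have : j != k.+1 by apply: contraNneq lamk1 => <-.
    by have : j != 2 * k.+1 by [apply: contraNneq lam2k => <-]; lia.
  have e := sumn_shift_down lam1.
  split; [|by rewrite shift_downK|by rewrite /wtD /=; lia].
  apply/and5P; split=> //; last by rewrite size_shift_down // -sz addn1.
    apply/allP => j; rewrite mem_shift_down // => jl; have /= := allP lamk _ jl.
    by have : j + 2 != k.+1 by [apply: contraNneq lamk1 => <-]; lia.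
  by rewrite mem_shift_down // -mulnSr.
- move=> [[t lam] mu]; rewrite inPkE /= => /and5P[/eqP-> lamk lam2k muk /eqP sz].
  rewrite shift_upK; split=> //; apply/andP; split.
    apply/and3P; split=> //=; last by rewrite size_shift_up sz addn1 prednK.
    by apply/allP => j; rewrite mem_shift_up => /andP[j0 /(allP lamk)] /=; lia.
  apply/andP; split; rewrite mem_shift_up; last by rewrite mulnSr addnK negb_and lam2k orbT.
  by apply/negP => /andP[j0 /(allP lamk)] /=; lia.
Qed.

(** * Passing from [k] to [k+1] *)

Definition raise_rank (k : nat) (y : lam_mu) : triple :=
  let b := nb (2 * k.+1) y.1 in
  (tau k.+1,
   set_mult (nb k.+1 y.1 + b).-1 k.+1 (set_mult 0 (2 * k.+1) y.1),
   set_mult b k.+1 y.2).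

Definition lower_rank (k : nat) (x : triple) : lam_mu :=
  let b := nb k.+1 x.2 in
  (set_mult b (2 * k.+1) (set_mult (nb k.+1 x.1.2 + 1 - b) k.+1 x.1.2),
   set_mult 0 k.+1 x.2).

(** Whether or not [k+1] occurs in [lam], the resulting multiplicities are [a+b-1] and [b], so one
    formula serves both cases. The deleted [k+1] and the discarded [4k+1] make [5k+2], the growth of
    [tau]. *)
Lemma wequiv_raise_rank (n k : nat) :
  wequiv (fun y : {y | inD n k 1 y && ~~ no_low_part k y} => wtD k (4 * k + 1) (val y))
         (fun x : {x | inH n k.+1 x} => wt (val x)).
Proof.
apply: (wequiv_sub (f := raise_rank k) (g := lower_rank k)).
- move=> [lam mu]; rewrite inHE inPkE => /andP[/and3P[/= lamk muk /eqP sz]].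
  rewrite /no_low_part /= negb_and !negbK !nb_gt0 -addn_gt0.
  have mu0 : nb k.+1 mu = 0 by apply: nb_eq0; apply/negP => /(allP muk) /=; lia.
  have k2 : (2 * k.+1 == k.+1) = false by lia.
  have k2' : (k.+1 == 2 * k.+1) = false by lia.
  have k02 : 0 < 2 * k.+1 by lia.
  rewrite /raise_rank /lower_rank /wtD /=.
  case e: (_ + _) => [//|c] _ /=.
  have := size_set_mult c (set_mult 0 (2 * k.+1) lam) (ltn0Sn k).
  have := size_set_mult 0 lam k02.
  have := sumn_set_mult c k.+1 (set_mult 0 (2 * k.+1) lam).
  have := sumn_set_mult 0 (2 * k.+1) lam.
  have := sumn_set_mult (nb (2 * k.+1) lam) k.+1 mu.
  rewrite !nb_set_mult // !eqxx k2' mu0 sumn_tauS => e1 e2 e3 e4 e5.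
  (* With [e] multiplied by [k+1] and expanded, the weight identity becomes linear. *)
  have e6 : k.+1 * nb k.+1 lam + k.+1 * nb (2 * k.+1) lam = k.+1 * c + k.+1.
    by rewrite -mulnDr e mulnS addnC.
  split; last by lia.
  + apply/andP; split; last by lia.
    apply/and5P; split=> //; last by apply/eqP; lia.
    * apply: all_set_mult => //= j; rewrite mem_set_mult //.
      by case: eqP => // _ /(allP lamk).
    * by rewrite k2.
    * by apply: all_set_mult => //= j /(allP muk) /= jk _; exact: leqW.
  + congr (_, _); apply: intpart_ext => j; rewrite !nb_set_mult //.
      case: (eqVneq j (2 * k.+1)) => [->//|_].
      by case: (eqVneq j k.+1) => [->|//]; lia.
    by case: (eqVneq j k.+1) => [->|].
- move=> [[t lam] mu]; rewrite inHE inPkE /=.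
  case/andP=> /and5P[/eqP -> lamk lam2k muk /eqP sz] lt2.
  have lam0 := nb_eq0 lam2k.
  have k2 : (2 * k.+1 == k.+1) = false by lia.
  have k2' : (k.+1 == 2 * k.+1) = false by lia.
  have k02 : 0 < 2 * k.+1 by lia.
  rewrite /raise_rank /lower_rank /inD /no_low_part /=.
  set c := (_ + 1 - _).
  (* The condition of [H] makes the subtraction exact. The sum being positive, [k+1] or [2k+2]
     occurs in the preimage. *)
  have cE : c + nb k.+1 mu = nb k.+1 lam + 1 by rewrite /c; lia.
  move: c cE => c cE.
  have := size_set_mult (nb k.+1 mu) (set_mult c k.+1 lam) k02.
  have := size_set_mult c lam (ltn0Sn k).
  rewrite !nb_set_mult // !eqxx k2 k2' lam0 => e1 e2.
  split.
  + apply/andP; split; last by rewrite !mem_set_mult // !eqxx k2'; lia.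
    apply/and3P; split; last by apply/eqP; lia.
    * apply: all_set_mult => //= [j|]; last by lia.
      by rewrite mem_set_mult //; case: eqP => [-> //|_ /(allP lamk)].
    * apply: all_set_mult => //= j /(allP muk) /= jk /eqP; lia.
  + congr (_, _, _); apply: intpart_ext => j; rewrite !nb_set_mult //.
      case: (eqVneq j k.+1) => [->|_]; first by lia.
      by case: eqP => [->|].
    by case: (eqVneq j k.+1) => [->|].
Qed.

(** * Assembling the bijection *)

Definition wtS (m n k : nat) (x : single m * Pnk n k) : nat :=
  val x.1 + wt (val x.2).

Definition wtT (n k : nat) : target n k -> nat :=
  wsum (wsum (wsum (@wtS n n k) (@wtS (2 * n - 1) n.-1 k))
             (fun x : Hnk n k => wt (val x)))
       (fun x : Hnk n k.+1 => wt (val x)).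

Lemma weightE (n : nat) (x : triple) :
  weight n x = (indet_a ^+ n * indet_q ^+ wt x)%R.
Proof. by case: x => -[]. Qed.

(** Every summand carries the factor [a^n], the second one as [a] times [a^(n-1)] with [0 < n], so
    only exponents of [q] remain to compare. *)
Lemma weightTE (n k : nat) (y : target n k) : 0 < n ->
  weightT y = (indet_a ^+ n * indet_q ^+ wtT y)%R.
Proof.
move=> n0; case: y => [[[] [m x]|x]|x] /=; rewrite weightE /wtS /= ?GRing.exprD //.
- by rewrite GRing.mulrCA.
- by rewrite GRing.mulrACA -GRing.exprS prednK.
Qed.

Lemma wequiv_target (n k : nat) : 0 < n ->
  wequiv (fun x : Pnk n k => wt (val x)) (@wtT n k).
Proof.
move=> n0.
have wtSE m j : wequiv (fun x : Pnk j k => m + wt (val x)) (@wtS m j k).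
  by apply: wequiv_single => -[[i im] x]; rewrite /wtS /= (eqP im).
have eC := wequiv_trans (wequiv_split _ (no_low_part k) _)
  (wequiv_sum (wequiv_trans (wequiv_shift2 k n0) (wtSE _ _)) (wequiv_raise_rank n k)).
have eD := wequiv_trans (wequiv_split _ (fun y => 2 * k + 1 \notin parts y.1) _)
  (wequiv_sum (wequiv_trans (wequiv_shift1 n k) (wtSE _ _))
              (wequiv_trans (wequiv_drop n k) eC)).
have eH : wequiv (fun x : {x | inP n k x && inH n k x} => wt (val x))
                 (fun x : Hnk n k => wt (val x)).
  apply: (wequiv_sub (f := id) (g := id)) => [x /andP[]|[[t lam] mu] Hx] //.
  by split=> //; rewrite Hx andbT; case/andP: Hx.
apply: wequiv_trans (wequiv_split (inP n k) (inH n k) wt) _.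
apply: wequiv_trans (wequiv_sum eH (wequiv_trans (wequiv_notH n k) eD)) _.
(* The successive splits yield a right-nested sum headed by [H_{n,k}]; this reorders it into the
   shape of [target]. *)
exists (fun x => match x with
  | inl h => inl (inr h)
  | inr (inl y) => inl (inl (inl y))
  | inr (inr (inl y)) => inl (inl (inr y))
  | inr (inr (inr h)) => inr h
  end); split=> [|[h|[y|[y|h]]]] //.
exists (fun x => match x with
  | inl (inr h) => inl h
  | inl (inl (inl y)) => inr (inl y)
  | inl (inl (inr y)) => inr (inr (inl y))
  | inr h => inr (inr (inr h))
  end); [by case=> [h|[y|[y|h]]] | by case=> [[[y|y]|h]|h]].
Qed.

Theorem theorem2p1 (n k : nat) (hn : 0 < n) :
  exists phi : Pnk n k -> target n k,
    bijective phi /\ (forall x : Pnk n k, weightT (phi x) = weightP x).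
Proof.
have [phi [bphi wphi]] := wequiv_target k hn.
by exists phi; split=> // x; rewrite weightTE // wphi /weightP weightE.
Qed.
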